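(* Suppose $\mathcal{G}=(V,E)$ is a countable weakly ultrahomogeneous graph. Then $\mathcal{G}$ is a disjoint union of $\mathcal{H}$ and $mK_n$ for some fixed $0\le m,n\le\aleph_0$, where $\mathcal{H}$ is a graph with finitely many connected components.
   Context: Graphs are simple and undirected, viewed as structures in the language of one binary relation (adjacency). $K_n$ is the complete graph on $n$ vertices ($n\le\aleph_0$) and $mK_n$ is the disjoint union of $m$ copies of $K_n$. $\mathcal{G}$ is weakly ultrahomogeneous if there is a finite set $\{a_1,\dots,a_k\}\subseteq V$ such that every isomorphism between finite induced subgraphs of $\mathcal{G}$ containing all $a_i$ and fixing each $a_i$ extends to an automorphism of $\mathcal{G}$. *)

(* Defs.v *)
From mathcomp Require Export all_boot all_order.
From mathcomp Require Export boolp classical_sets functions cardinality.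
From Stdlib Require Export Relation_Operators.

Set Implicit Arguments.
Unset Strict Implicit.
Unset Printing Implicit Defensive.

Local Open Scope classical_set_scope.

Record graph := Graph {
  vertex :> Type;
  edge : vertex -> vertex -> Prop;
  edge_sym : forall x y, edge x y -> edge y x;
  edge_irrefl : forall x, ~ edge x x
}.

Definition is_iso (G H : graph) (f : G -> H) : Prop :=
  bijective f /\ forall x y : G, edge x y <-> edge (f x) (f y).

Definition isomorphic (G H : graph) : Prop := exists f : G -> H, is_iso f.

Section Induced.
Variables (G : graph) (S : set G).

Definition ind_edge (x y : set_type S) : Prop := edge (val x) (val y).

Lemma ind_edge_sym x y : ind_edge x y -> ind_edge y x.
Proof. exact: edge_sym. Qed.

Lemma ind_edge_irrefl x : ~ ind_edge x x.
Proof. exact: edge_irrefl. Qed.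

Definition induced : graph := Graph ind_edge_sym ind_edge_irrefl.
End Induced.

Definition weakly_ultrahomogeneous (G : graph) : Prop :=
  exists A : set G, finite_set A /\
    forall (S T : set G) (f : induced S -> induced T),
      finite_set S -> finite_set T -> A `<=` S -> A `<=` T ->
      is_iso f ->
      (forall x : set_type S, A (val x) -> val (f x) = val x) ->
      exists g : G -> G,
        is_iso g /\ forall x : set_type S, g (val x) = val (f x).

Section DisjointUnion.
Variables G H : graph.

Definition du_edge (x y : G + H) : Prop :=
  match x, y with
  | inl u, inl v => edge u v
  | inr u, inr v => edge u v
  | _, _ => False
  end.

Lemma du_edge_sym x y : du_edge x y -> du_edge y x.
Proof. by case: x y => [x|x] [y|y] //=; exact: edge_sym. Qed.

Lemma du_edge_irrefl x : ~ du_edge x x.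
Proof. by case: x => x /=; exact: edge_irrefl. Qed.

Definition disjoint_union : graph := Graph du_edge_sym du_edge_irrefl.
End DisjointUnion.

(* Cardinals at most aleph_0: [Some k] is the finite cardinal k and [None] is
   aleph_0; each is represented by an initial segment of nat. *)
Definition cardinal_le_aleph0 := option nat.

Definition initial_segment (n : cardinal_le_aleph0) : set nat :=
  if n is Some k then `I_k else setT.

Section Complete.
Variable n : cardinal_le_aleph0.

Definition complete_edge (x y : set_type (initial_segment n)) : Prop := x <> y.

Lemma complete_edge_sym x y : complete_edge x y -> complete_edge y x.
Proof. by move=> xy yx; apply: xy. Qed.

Lemma complete_edge_irrefl x : ~ complete_edge x x.
Proof. by move=> xx; apply: xx. Qed.

Definition complete_graph : graph :=
  Graph complete_edge_sym complete_edge_irrefl.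
End Complete.

Section Copies.
Variables (m : cardinal_le_aleph0) (G : graph).

Definition copies_edge (x y : set_type (initial_segment m) * G) : Prop :=
  x.1 = y.1 /\ edge x.2 y.2.

Lemma copies_edge_sym x y : copies_edge x y -> copies_edge y x.
Proof. by case=> xy1 xy2; split=> //; exact: edge_sym. Qed.

Lemma copies_edge_irrefl x : ~ copies_edge x x.
Proof. by case=> _; exact: edge_irrefl. Qed.

Definition copies : graph := Graph copies_edge_sym copies_edge_irrefl.
End Copies.

Definition component (G : graph) (x : G) : set G :=
  [set y | clos_refl_trans G (@edge G) x y].

Definition components (G : graph) : set (set G) := range (@component G).
Arguments components : clear implicits.

(* Main.v *)
Require Import Defs.
From mathcomp Require Import all_boot all_order.
From mathcomp Require Import boolp classical_sets functions cardinality.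

Set Implicit Arguments.
Unset Strict Implicit.

Local Open Scope classical_set_scope.

(** Let [A] be the finite set witnessing weak ultrahomogeneity, and call a
    vertex free when its component misses [A].  Only finitely many components
    meet [A].  A free vertex has no neighbour in [A], so any two free vertices
    look alike from [A], and some automorphism carries one to the other
    ([one_point_extensionP]); hence all free components have the same
    cardinality ([free_components_equipotent]).

    Suppose moreover that free vertices [x] and [z] lie in different
    components.  If [x] had a non-neighbour [y] distinct from [x] in its own
    component, then [y] and [z] would look alike from [A] together with [x],
    and an automorphism fixing [x] would send [y], connected to [x], to [z],
    not connected to [x].  Thus every free component is complete
    ([free_component_complete]).

    When there are finitely many free components the whole graph has finitely
    many components, and it serves as [H], with [m = 0].  Otherwise [H] is the
    union of the components meeting [A], and the free components are
    countably many complete graphs of one and the same size, that is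
    [m = aleph_0]. *)

(** * Connected components *)

Section Components.
Variable G : graph.
Implicit Types x y z : G.

Lemma component_refl x : component x x.
Proof. exact: rt_refl. Qed.

Lemma component_sym x y : component x y -> component y x.
Proof.
elim=> [u v uv|u|u v w _ vu _ wv]; first exact/rt_step/edge_sym.
- exact: rt_refl.
- exact: rt_trans wv vu.
Qed.

Lemma component_trans x y z : component x y -> component y z -> component x z.
Proof. exact: rt_trans. Qed.

Lemma edge_component x y : edge x y -> component x y.
Proof. exact: rt_step. Qed.

Lemma component_eqP x y : component x = component y <-> component x y.
Proof.
split=> [->|xy]; first exact: component_refl.
apply/seteqP; split=> z; last exact: component_trans.
exact/component_trans/component_sym.
Qed.

End Components.

Lemma iso_component (G H : graph) (f : G -> H) (x y : G) :
  is_iso f -> component x y -> component (f x) (f y).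
Proof.
move=> [_ fE]; elim=> [u v uv|u|u v w _ IH1 _ IH2].
- exact/edge_component/fE.
- exact: component_refl.
- exact: component_trans IH1 IH2.
Qed.

Lemma iso_inverse (G H : graph) (f : G -> H) : is_iso f ->
  exists2 g : H -> G, is_iso g & cancel f g /\ cancel g f.
Proof.
move=> [[g fK gK] fE]; exists g => //; split; first by exists f.
by move=> x y; rewrite fE !gK.
Qed.

Lemma iso_component_image (G : graph) (g : G -> G) (x : G) :
  is_iso g -> g @` component x = component (g x).
Proof.
move=> gI; apply/seteqP; split=> [_ [y xy <-]|y gxy].
  exact: iso_component.
have [h hI [gK hK]] := iso_inverse gI.
exists (h y); last exact: hK.
by have := iso_component hI gxy; rewrite gK.
Qed.

Definition saturation (G : graph) (A : set G) : set G :=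
  [set x | exists2 a, A a & component a x].

Lemma saturation_component (G : graph) (A : set G) (x y : G) :
  component x y -> saturation A x -> saturation A y.
Proof. by move=> xy [a Aa ax]; exists a => //; exact: component_trans xy. Qed.

(** A path that starts in a saturated set never leaves it, so passing to the
    induced subgraph does not break components. *)
Lemma component_induced (G : graph) (W : set G) (x y : induced W) :
  (forall u v : G, edge u v -> W u -> W v) ->
  component (val x) (val y) -> component x y.
Proof.
move=> Wedge; case: x y => [x xW] [y yW] /= xy.
elim: xy xW yW => {x y} [u v uv|u|u v w uv IH1 vw IH2] uW wW.
- exact: edge_component.
- rewrite (_ : exist _ u wW = exist _ u uW); last exact: val_inj.
  exact: component_refl.
- have vW : v \in W.
    move: uW; rewrite !inE.
    elim: uv {IH1 IH2 vw wW} => [|//|a b c _ IH1 _ IH2 /IH1 /IH2 //].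
    exact: Wedge.
  exact: component_trans (IH1 uW vW) (IH2 vW wW).
Qed.

Lemma component_val (G : graph) (W : set G) (x y : induced W) :
  component x y -> component (val x) (val y).
Proof.
elim=> [u v uv|u|u v w _ IH1 _ IH2].
- exact: edge_component.
- exact: component_refl.
- exact: component_trans IH1 IH2.
Qed.

(** Each component of the saturation is the trace of the component of some
    [a] in [A], so there are at most as many of them as elements of [A]. *)
Lemma finite_components_saturation (G : graph) (A : set G) :
  finite_set A -> finite_set (components (induced (saturation A))).
Proof.
move=> /(finite_image
  (fun a => [set y : induced (saturation A) | component a (val y)])).
apply: sub_finite_set => _ [x _ <-].
have [a Aa ax] := set_mem (valP x).
exists a => //; apply/seteqP; split=> y /= ay.
  apply: component_induced => [u v uv|]; last first.
    exact: component_trans (component_sym ax) ay.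
  exact/saturation_component/edge_component.
exact: component_trans ax (component_val ay).
Qed.

(** * One-point extensions *)

(** Weak ultrahomogeneity with base [A], specialized to partial isomorphisms
    that move at most one vertex: vertices with the same neighbours in a finite [B]
    containing [A] are related by an automorphism fixing [B] pointwise. *)
Definition one_point_extension (G : graph) (A : set G) : Prop :=
  forall (B : set G) (u v : G), finite_set B -> A `<=` B -> ~ B u -> ~ B v ->
    (forall b, B b -> edge b u <-> edge b v) ->
    exists g : G -> G, [/\ is_iso g, forall b, B b -> g b = b & g u = v].

Section Move.
Variables (G : graph) (B : set G).

Definition move (u v x : G) : G := if pselect (x = u) is left _ then v else x.

Lemma move_src (u v : G) : move u v u = v.
Proof. by rewrite /move; case: pselect. Qed.

Lemma move_base (u v x : G) : ~ B u -> B x -> move u v x = x.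
Proof. by move=> Bu Bx; rewrite /move; case: pselect => // xu; subst. Qed.

Lemma move_sub (u v x : G) : x \in u |` B -> move u v x \in v |` B.
Proof.
rewrite !inE /move => -[->|Bx]; case: pselect => // _; first by left.
  by left.
by right.
Qed.

Definition move_induced (u v : G) (x : induced (u |` B)) : induced (v |` B) :=
  exist _ (move u v (val x)) (move_sub v (valP x)).

Lemma move_inducedK (u v : G) : ~ B u -> ~ B v ->
  cancel (@move_induced u v) (@move_induced v u).
Proof.
move=> Bu Bv [x xS]; apply: val_inj => /=.
move: (xS); rewrite inE => -[->|Bx]; first by rewrite !move_src.
by rewrite (move_base _ _ Bx)// (move_base _ _ Bx).
Qed.

(** The map is the identity on [B], so the only edges to compare are those
    between [B] and the moved vertex. *)
Lemma move_induced_iso (u v : G) : ~ B u -> ~ B v ->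
  (forall b, B b -> edge b u <-> edge b v) -> is_iso (@move_induced u v).
Proof.
move=> Bu Bv uvE; split.
  by exists (@move_induced v u); exact: move_inducedK.
have symE (b c : G) : edge b c <-> edge c b by split; exact: edge_sym.
move=> [x xS] [y yS]; rewrite /= /ind_edge /=.
move: (xS) (yS); rewrite !inE => -[->|Bx] -[->|By];
  rewrite ?move_src ?(move_base _ Bu Bx) ?(move_base _ Bu By) //.
- by split=> /edge_irrefl.
- by rewrite symE uvE// symE.
- exact: uvE.
Qed.

End Move.

Lemma one_point_extensionP (G : graph) : weakly_ultrahomogeneous G ->
  exists2 A : set G, finite_set A & one_point_extension A.
Proof.
move=> [A [finA extA]]; exists A => // B u v finB AB Bu Bv uvE.
have fin1 (w : G) : finite_set (w |` B) by rewrite finite_setU.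
have sub1 (w : G) : A `<=` w |` B by move=> x /AB; right.
have [|g [gI gE]] := extA _ _ (@move_induced G B u v) (fin1 u) (fin1 v)
  (sub1 u) (sub1 v) (move_induced_iso Bu Bv uvE).
  by move=> x /AB Bx /=; exact: move_base Bu Bx.
have gval (x : G) : (u |` B) x -> g x = move u v x.
  by move=> ux; exact: (gE (exist _ x (mem_set ux))).
exists g; split=> // [b Bb|].
  by rewrite gval; [exact: move_base Bu Bb | right].
by rewrite gval; [exact: move_src | left].
Qed.

(** * Components missing the base *)

Section Free.
Variables (G : graph) (A : set G).
Hypotheses (finA : finite_set A) (extA : one_point_extension A).

Lemma not_saturation_base (x : G) : ~ saturation A x -> ~ A x.
Proof. by move=> Fx Ax; apply: Fx; exists x => //; exact: component_refl. Qed.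

Lemma not_saturation_edge (x b : G) : ~ saturation A x -> A b -> ~ edge b x.
Proof. by move=> Fx Ab bx; apply: Fx; exists b => //; exact: edge_component. Qed.

(** Neither [x] nor [y] has a neighbour in [A], so an automorphism maps [x] to
    [y], and therefore the component of [x] onto that of [y]. *)
Lemma free_components_equipotent (x y : G) :
  ~ saturation A x -> ~ saturation A y -> (component x #= component y)%card.
Proof.
move=> Fx Fy.
have sameE (b : G) : A b -> edge b x <-> edge b y.
  by move=> Ab; split=> /not_saturation_edge; case.
have [g [gI _ <-]] := extA finA (@subset_refl _ A)
  (not_saturation_base Fx) (not_saturation_base Fy) sameE.
rewrite -iso_component_image// card_eq_sym.
by apply: inj_card_eq => u v _ _; apply: bij_inj; case: gI.
Qed.

(** If [x] and [y] were not adjacent, then [y] and [z] would both have no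
    neighbour in [A] together with [x]; an automorphism fixing [x] and sending
    [y] to [z] would then connect [x] to [z]. *)
Lemma free_component_complete (x y z : G) :
  ~ saturation A x -> ~ saturation A z -> ~ component x z ->
  component x y -> x <> y -> edge x y.
Proof.
move=> Fx Fz xz xy neq_xy; apply: contrapT => not_xy.
have Fy : ~ saturation A y.
  by move=> /(saturation_component (component_sym xy)).
have Bz : ~ (x |` A) z.
  move=> [zx|]; last exact: not_saturation_base.
  by apply: xz; rewrite zx; exact: component_refl.
have By : ~ (x |` A) y by move=> [/esym|]; last exact: (not_saturation_base Fy).
have sameE b : (x |` A) b -> edge b y <-> edge b z.
  move=> [->|Ab]; first by split=> [//|/edge_component].
  by split=> /not_saturation_edge; case.
have finB : finite_set (x |` A) by rewrite finite_setU.
have [g [gI gx gy]] := extA finB (@subsetUr _ [set x] A) By Bz sameE.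
by apply: xz; rewrite -gy -(gx x (or_introl erefl)); exact: iso_component.
Qed.

End Free.

(** * Recognizing the decomposition *)

(** A vertex outside [W] is encoded by two numbers: [i] is the index of its
    copy of [K_n] and [j] its position in that copy. *)
Lemma isomorphic_from_coordinates (G : graph) (W : set G)
    (m n : cardinal_le_aleph0) (i j : G -> nat) :
  (forall x y : G, edge x y -> W x -> W y) ->
  (forall x : G, ~ W x -> initial_segment m (i x)) ->
  (forall x : G, ~ W x -> initial_segment n (j x)) ->
  (forall p q, initial_segment m p -> initial_segment n q ->
     exists x : G, [/\ ~ W x, i x = p & j x = q]) ->
  (forall x y : G, ~ W x -> ~ W y -> i x = i y -> j x = j y -> x = y) ->
  (forall x y : G, ~ W x -> ~ W y -> edge x y <-> i x = i y /\ x <> y) ->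
  isomorphic G (disjoint_union (induced W) (copies m (complete_graph n))).
Proof.
move=> Wedge im jn surj inj ijE.
pose f (x : G) : disjoint_union (induced W) (copies m (complete_graph n)) :=
  match pselect (W x) with
  | left Wx => inl (exist _ x (mem_set Wx))
  | right Fx => inr (exist _ (i x) (mem_set (im x Fx)),
                     exist _ (j x) (mem_set (jn x Fx)))
  end.
exists f; split.
  rewrite -setTT_bijective; split=> //.
    move=> x y _ _; rewrite /f.
    case: pselect => Wx; case: pselect => Wy // [].
      by [].
    exact: inj.
  move=> [[x xW]|[[p pm] [q qn]]] _.
    exists x => //; rewrite /f; case: pselect => [Wx|]; last by case; exact: set_mem.
    by congr inl; exact: val_inj.
  have [x [Fx ip jq]] := surj p q (set_mem pm) (set_mem qn).
  exists x => //; rewrite /f; case: pselect => // Fx'.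
  by congr (inr (_, _)); exact: val_inj.
move=> x y; rewrite /f; case: pselect => Wx; case: pselect => Wy //=.
- by split=> // /Wedge /(_ Wx).
- by split=> // /edge_sym /Wedge /(_ Wy).
rewrite ijE//; split=> [[ixy nxy]|[[ixy] jxy]].
  split; first exact: val_inj.
  by move=> [jxy]; apply: nxy; exact: inj.
split=> // xy; apply: jxy; apply: val_inj => /=.
by rewrite xy.
Qed.

Lemma isomorphic_no_copies (G : graph) (n : cardinal_le_aleph0) :
  isomorphic G (disjoint_union G (copies (Some 0) (complete_graph n))).
Proof.
exists inl; split=> //; rewrite -setTT_bijective; split=> //.
- by move=> x y _ _ [].
- by move=> [x _|[[p p0]]]; [exists x | move: (set_mem p0)].
Qed.

Lemma countable_cardinal (T : Type) (C : set T) : countable C ->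
  exists n, (C #= initial_segment n)%card.
Proof.
move=> cC; have [[k Ck]|infC] := pselect (finite_set C).
  by exists (Some k).
by exists None; exact: eq_card_nat.
Qed.

Unset Implicit Arguments.
Set Strict Implicit.

Theorem proposition6p1 (G : graph)
    (countableG : countable [set: G])
    (whG : weakly_ultrahomogeneous G) :
  exists (H : graph) (m n : cardinal_le_aleph0),
    finite_set (components H) /\
    isomorphic G (disjoint_union H (copies m (complete_graph n))).
Proof.
have [A finA extA] := one_point_extensionP whG.
pose W := saturation A.
pose K := [set component x | x in ~` W].
have [finK|infK] := pselect (finite_set K).
  exists G, (Some 0), (Some 0); split; last exact: isomorphic_no_copies.
  apply: (@sub_finite_set _ _ ([set component a | a in A] `|` K)).
    move=> _ [x _ <-]; have [[a Aa ax]|Fx] := pselect (W x).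
      by left; exists a => //; exact/component_eqP.
    by right; exists x.
  by rewrite finite_setU; split=> //; exact: finite_image.
have [_ [x0 Fx0 _]] := infinite_setN0 infK.
have [n Cn] : exists n, (component x0 #= initial_segment n)%card.
  by apply: countable_cardinal; exact: sub_countable (card_leT _) countableG.
have countK : countable K.
  apply: sub_countable (card_image_le _ _) _.
  exact: sub_countable (card_leT _) countableG.
have /card_set_bijP [c [_ cinj csurj]] := eq_card_nat countK infK.
(* The numbering is attached to the component, so that connected vertices use
   the same one. *)
have [J JP] : {J : set G -> G -> nat & forall C,
    K C -> set_bij C (initial_segment n) (J C)}.
  apply: (@choice _ _ (fun C h => K C -> set_bij C (initial_segment n) h)) => C.
  have [KC|] := pselect (K C); last by exists (fun=> 0).
  case: (KC) => x Fx xC; rewrite -xC.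
  have /card_set_bijP [h hP] : (component x #= initial_segment n)%card.
    exact: card_eq_trans (free_components_equipotent finA extA Fx Fx0) Cn.
  by exists h.
have inK x : ~ W x -> K (component x) by move=> Fx; exists x.
have indexE x y : ~ W x -> ~ W y ->
    c (component x) = c (component y) <-> component x y.
  move=> Fx Fy; rewrite -component_eqP; split=> [|-> //].
  by apply: cinj; rewrite inE; exact: inK.
exists (induced W), None, n; split; first exact: finite_components_saturation.
apply: (@isomorphic_from_coordinates _ _ _ _
  (fun x => c (component x)) (fun x => J (component x) x)) => //.
- by move=> x y /edge_component; exact: saturation_component.
- move=> x Fx; have [Jseg _ _] := JP _ (inK x Fx).
  exact/Jseg/component_refl.
- move=> p q _ nq; have [_ [x Fx <-] cx] := csurj p I.
  have [_ _ /(_ q nq) [y xy Jy]] := JP _ (inK x Fx).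
  exists y; move/component_eqP: (xy) => <-; split=> //.
  by move=> /(saturation_component (component_sym xy)).
- move=> x y Fx Fy /(indexE _ _ Fx Fy) xy.
  have [_ Jinj _] := JP _ (inK x Fx).
  move/component_eqP: (xy) => <-; apply: Jinj; rewrite inE //.
  exact: component_refl.
- move=> x y Fx Fy; rewrite indexE//; split=> [xy|[xy nxy]].
    split; first exact: edge_component.
    by move=> exy; apply: (@edge_irrefl _ x); rewrite {2}exy.
  (* One component is not all of the infinite family [K]. *)
  have [z Fz xz] : exists2 z, ~ W z & ~ component x z.
    apply: contrapT => no_z; apply: infK.
    apply: (@sub_finite_set _ _ [set component x]) => // _ [z Fz <-].
    apply: esym; apply/component_eqP; apply: contrapT => xz.
    by apply: no_z; exists z.
  exact: (free_component_complete finA extA Fx Fz xz).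
Qed.
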